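(* Let $\Gamma$ be a finite graph and let $t$ be a vertex of $\Gamma$. Then $A(D_{\mathrm{St}_\Gamma(t)}(\Gamma))$ embeds into $A(\Gamma)$.
   Context: A graph is a simplicial 1-complex (no loops, no multi-edges). For a graph $\Gamma$ with vertex set $V(\Gamma)$ and edge set $E(\Gamma)$, the right-angled Artin group is $A(\Gamma)=\langle V(\Gamma)\mid [v,v']=1 \text{ for each } \{v,v'\}\in E(\Gamma)\rangle$. For a vertex $v$, the link $\mathrm{Lk}_\Gamma(v)$ is the set of vertices adjacent to $v$, and the star is $\mathrm{St}_\Gamma(v)=\mathrm{Lk}_\Gamma(v)\cup\{v\}$. For a set $L$ of vertices of $\Gamma$, the double $D_L(\Gamma)$ of $\Gamma$ along $L$ is the graph obtained by taking two copies of $\Gamma$ and gluing them along the copies of the induced subgraph on $L$. A group $H$ embeds into $G$ if there is an injective homomorphism $H\to G$. *)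

(* Defs.v *)
From HB Require Import structures.
From mathcomp Require Import all_boot boolp.
From mathcomp Require Import monoid.

Set Implicit Arguments.
Unset Strict Implicit.
Unset Printing Implicit Defensive.

Local Open Scope quotient_scope.

Section Presentation.

Variable X : choiceType.

(* A letter (x, false) stands for the generator x, (x, true) for its formal
   inverse. *)
Definition word := seq (X * bool).

Definition word_inv (w : word) : word := [seq (a.1, ~~ a.2) | a <- rev w].

Definition word_comm (x y : X) : word :=
  [:: (x, true); (y, true); (x, false); (y, false)].

Variable R : word -> Prop.

Inductive pres_eq : word -> word -> Prop :=
| pres_refl u : pres_eq u u
| pres_sym u v : pres_eq u v -> pres_eq v u
| pres_trans v u w : pres_eq u v -> pres_eq v w -> pres_eq u w
| pres_cancel u x b v : pres_eq (u ++ [:: (x, b); (x, ~~ b)] ++ v) (u ++ v)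
| pres_rel u r v : R r -> pres_eq (u ++ r ++ v) (u ++ v).

(* The congruence is in Prop: boolp makes it boolean, as {eq_quot _} requires. *)
Definition pres_eqb : rel word := fun u v => `[< pres_eq u v >].

Lemma pres_eqb_refl : reflexive pres_eqb.
Proof. by move=> u; apply/asboolP; exact: pres_refl. Qed.

Lemma pres_eqb_sym : symmetric pres_eqb.
Proof. by move=> u v; apply/asboolP/asboolP; exact: pres_sym. Qed.

Lemma pres_eqb_trans : transitive pres_eqb.
Proof.
by move=> v u w /asboolP uv /asboolP vw; apply/asboolP; exact: pres_trans vw.
Qed.

Canonical pres_equiv : equiv_rel word :=
  EquivRel pres_eqb pres_eqb_refl pres_eqb_sym pres_eqb_trans.

(* The group < X | r = 1 for each r satisfying R >. *)
Definition presented := {eq_quot pres_equiv}.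

HB.instance Definition _ := Choice.on presented.

Definition pres_class (w : word) : presented := \pi_{eq_quot pres_equiv} w.

Definition pres_repr (g : presented) : word :=
  repr (g : {eq_quot pres_equiv}).

Lemma pres_reprK : cancel pres_repr pres_class.
Proof. by move=> g; rewrite /pres_class /pres_repr reprK. Qed.

Lemma pres_classP u v : pres_class u = pres_class v <-> pres_eq u v.
Proof.
split; first by move/eqmodP => /asboolP.
by move=> uv; apply/eqmodP; apply/asboolP.
Qed.

Lemma pres_repr_eq w : pres_eq (pres_repr (pres_class w)) w.
Proof. by apply/pres_classP; rewrite pres_reprK. Qed.

Lemma pres_eq_ctx a b u v : pres_eq u v -> pres_eq (a ++ u ++ b) (a ++ v ++ b).
Proof.
elim=> [w|{}u {}v _|{}v {}u w _ uv _|{}u x c {}v|{}u r {}v Rr].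
- exact: pres_refl.
- exact: pres_sym.
- exact: pres_trans.
- by have := pres_cancel (a ++ u) x c (v ++ b); rewrite -!catA.
- by have := pres_rel (a ++ u) (v ++ b) Rr; rewrite -!catA.
Qed.

Lemma pres_eq_cat u u' v v' :
  pres_eq u u' -> pres_eq v v' -> pres_eq (u ++ v) (u' ++ v').
Proof.
move=> /(pres_eq_ctx [::] v) /= uu' /(pres_eq_ctx u' [::]).
by rewrite !cats0; exact: pres_trans.
Qed.

Lemma word_invK : involutive word_inv.
Proof.
move=> w; rewrite /word_inv -map_rev revK -map_comp -[RHS]map_id.
by apply: eq_map => -[x b] /=; rewrite negbK.
Qed.

Lemma pres_eq_invr w : pres_eq (w ++ word_inv w) [::].
Proof.
elim: w => [|[x b] w IHw]; first exact: pres_refl.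
have -> : word_inv ((x, b) :: w) = word_inv w ++ [:: (x, ~~ b)].
  by rewrite /word_inv rev_cons map_rcons cats1.
apply: pres_trans (pres_cancel [::] x b [::]).
by have := pres_eq_ctx [:: (x, b)] [:: (x, ~~ b)] IHw; rewrite -catA.
Qed.

Definition pres_mul (g h : presented) : presented :=
  pres_class (pres_repr g ++ pres_repr h).

Definition pres_one : presented := pres_class [::].

Definition pres_inv (g : presented) : presented :=
  pres_class (word_inv (pres_repr g)).

Lemma pres_mul_class u v :
  pres_mul (pres_class u) (pres_class v) = pres_class (u ++ v).
Proof. by apply/pres_classP; apply: pres_eq_cat; exact: pres_repr_eq. Qed.

Lemma pres_mulA : associative pres_mul.
Proof.
move=> g h k; rewrite -(pres_reprK g) -(pres_reprK h) -(pres_reprK k).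
by rewrite !pres_mul_class catA.
Qed.

Lemma pres_mul1 : left_id pres_one pres_mul.
Proof. by move=> g; rewrite -(pres_reprK g) pres_mul_class. Qed.

Lemma pres_mulr1 : right_id pres_one pres_mul.
Proof. by move=> g; rewrite -(pres_reprK g) pres_mul_class cats0. Qed.

Lemma pres_mulrV : right_inverse pres_one pres_inv pres_mul.
Proof.
move=> g; rewrite -{1}(pres_reprK g) pres_mul_class.
by apply/pres_classP; exact: pres_eq_invr.
Qed.

Lemma pres_mulVr : left_inverse pres_one pres_inv pres_mul.
Proof.
move=> g; rewrite -{2}(pres_reprK g) pres_mul_class.
apply/pres_classP; rewrite -{2}[pres_repr g]word_invK; exact: pres_eq_invr.
Qed.

HB.instance Definition _ := isGroup.Build presented
  pres_mulA pres_mul1 pres_mulr1 pres_mulVr pres_mulrV.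

End Presentation.

Record graph := Graph {
  vertex :> finType;
  adj : rel vertex;
  adj_sym : symmetric adj;
  adj_irr : irreflexive adj
}.

Section Graphs.

Variable G : graph.

Definition link (v : G) : {set G} := [set w | adj v w].

Definition star (v : G) : {set G} := v |: link v.

Variable L : {set G}.

(* The first copy of G is the left summand; the second copy contributes only
   its vertices outside L, those in L being identified with the first copy. *)
Definition double_vertex : finType := (G + {x : G | x \notin L})%type.

Definition double_copy (b : bool) (x : G) : double_vertex :=
  if b then if insub x is Some y then inr y else inl x else inl x.

Definition double_adj : rel double_vertex := fun u v =>
  [exists b, exists x, exists y,
    [&& adj x y, double_copy b x == u & double_copy b y == v]].

Lemma double_copy_inj b : injective (double_copy b).
Proof.
case: b => [|x y [//]] x y; rewrite /double_copy.
case: insubP => [u _ <-|_]; case: insubP => [v _ <-|_] //.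
  by case=> ->.
by case.
Qed.

Lemma double_adj_sym : symmetric double_adj.
Proof.
have sub u v : double_adj u v -> double_adj v u.
  case/existsP=> b /existsP[x /existsP[y /and3P[xy xu yv]]].
  apply/existsP; exists b; apply/existsP; exists y; apply/existsP; exists x.
  by rewrite adj_sym xy xu yv.
by move=> u v; apply/idP/idP; exact: sub.
Qed.

Lemma double_adj_irr : irreflexive double_adj.
Proof.
move=> u; apply/negbTE/negP.
case/existsP=> b /existsP[x /existsP[y /and3P[xy /eqP <-]]].
by move=> /eqP/double_copy_inj yx; rewrite yx adj_irr in xy.
Qed.

Definition graph_double : graph := Graph double_adj_sym double_adj_irr.

End Graphs.

Inductive raag_relator (G : graph) : word G -> Prop :=
| RaagRelator (v w : G) : adj v w -> raag_relator (word_comm v w).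

Definition raag (G : graph) : groupType := presented (@raag_relator G).

Definition embeds (H G : groupType) : Prop :=
  exists f : {multiplicative H -> G}, injective f.

(* Main.v *)
(** The embedding sends t to t^2, a vertex v of the first copy to v, and a
    vertex v of the second copy to t v t^-1; its image is the index-two subgroup
    of words in which t has even exponent sum.  The inverse on that subgroup is
    the Reidemeister-Schreier rewriting for the transversal {1, t}: reading a
    word from left to right and remembering the parity b of the number of
    letters t and t^-1 met so far, a letter v or v^-1 with v different from t is
    replaced by the same letter in copy b, while t is emitted only when read
    with b = 1, and t^-1 only when read with b = 0. *)

From HB Require Import structures.
Require Import Defs.
From mathcomp Require Import all_boot.
From mathcomp Require Import boolp monoid.

Set Implicit Arguments.
Unset Strict Implicit.
Unset Printing Implicit Defensive.

Local Open Scope group_scope.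

Section PresentedGroup.

Variables (X : choiceType) (R : word X -> Prop).

Lemma pres_class_cat (u v : word X) :
  pres_class R (u ++ v) = pres_class R u * pres_class R v.
Proof. by rewrite -[LHS]pres_mul_class. Qed.

Lemma pres_class_nil : pres_class R [::] = 1.
Proof. by []. Qed.

Lemma pres_class_inv (w : word X) :
  pres_class R (word_inv w) = (pres_class R w)^-1.
Proof.
apply: (mulgI (pres_class R w)); rewrite mulgV -pres_class_cat -pres_class_nil.
by apply/pres_classP; exact: pres_eq_invr.
Qed.

(** [word_comm x y] spells x^-1 y^-1 x y, which is [[~ x, y]] in the convention of [commgP]. *)
Lemma word_comm_commute (x y : X) :
  R (word_comm x y) ->
  commute (pres_class R [:: (x, false)]) (pres_class R [:: (y, false)]).
Proof.
move=> Rxy; apply/commgP; apply/eqP.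
have <- : pres_class R (word_comm x y) = 1.
  by rewrite -pres_class_nil; apply/pres_classP; have := pres_rel [::] [::] Rxy.
rewrite -[word_comm x y]/(word_inv [:: (x, false)] ++ word_inv [:: (y, false)]
  ++ [:: (x, false)] ++ [:: (y, false)]).
by rewrite !pres_class_cat !pres_class_inv.
Qed.

End PresentedGroup.

(** * Homomorphisms defined on generators *)

Section Substitution.

Variables (X Y : choiceType) (f : X -> word Y).

Definition subst_letter (a : X * bool) : word Y :=
  if a.2 then word_inv (f a.1) else f a.1.

Definition subst_word (w : word X) : word Y := flatten (map subst_letter w).

Lemma subst_word_cat u v : subst_word (u ++ v) = subst_word u ++ subst_word v.
Proof. by rewrite /subst_word map_cat flatten_cat. Qed.

Variables (R : word X -> Prop) (S : word Y -> Prop).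

Hypothesis subst_rel :
  forall r, R r -> pres_class S (subst_word r) = 1.

(** Von Dyck's argument: killing the relators is enough, which makes the choice of representative in
    [subst_morph] immaterial. *)
Lemma subst_word_eq u v :
  pres_eq R u v -> pres_class S (subst_word u) = pres_class S (subst_word v).
Proof.
elim=> [//|{}u {}v _ -> //|{}v {}u w _ -> _ -> //|{}u x b {}v|{}u r {}v Rr].
- rewrite !subst_word_cat !pres_class_cat; congr (_ * _).
  rewrite -[RHS]mul1g; congr (_ * _).
  rewrite /subst_word /subst_letter /= pres_class_nil mulg1.
  by case: b; rewrite /= pres_class_inv ?mulVg ?mulgV.
- by rewrite !subst_word_cat !pres_class_cat (subst_rel Rr) mul1g.
Qed.

Definition subst_morph (g : presented R) : presented S :=
  pres_class S (subst_word (pres_repr g)).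

Lemma subst_morphM : {morph subst_morph : g h / g * h}.
Proof.
move=> g h; rewrite /subst_morph -pres_class_cat -subst_word_cat.
by apply: subst_word_eq; exact: pres_repr_eq.
Qed.

End Substitution.

Lemma subst_word_comm (X Y : choiceType) (f : X -> word Y) (S : word Y -> Prop)
    (x y : X) :
  commute (pres_class S (f x)) (pres_class S (f y)) ->
  pres_class S (subst_word f (word_comm x y)) = 1.
Proof.
move/commgP/eqP => <-.
by rewrite /subst_word /= cats0 !pres_class_cat !pres_class_inv.
Qed.

(** * The homomorphism from the double *)

Section DoubleAlongStar.

Variables (Gamma : graph) (t : Gamma).

Let D := graph_double (star t).
Let RG := @raag_relator Gamma.
Let RD := @raag_relator D.

Definition base_word (x : Gamma) : word Gamma :=
  if x == t then [:: (t, false); (t, false)] else [:: (x, false)].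

Definition double_word (z : D) : word Gamma :=
  match z with
  | inl x => base_word x
  | inr y => [:: (t, false); (val y, false); (t, true)]
  end.

Let gen (x : Gamma) : presented RG := pres_class RG [:: (x, false)].

Lemma base_word_commute x y : adj x y ->
  commute (pres_class RG (base_word x)) (pres_class RG (base_word y)).
Proof.
move=> xy; have gxy : commute (gen x) (gen y).
  by apply: word_comm_commute; exact: RaagRelator.
(* Powers of commuting elements commute, so t^2 needs no separate treatment. *)
have baseE z : exists n, pres_class RG (base_word z) = gen z ^+ n.
  rewrite /base_word; case: eqP => [->|_]; last by exists 1%N; rewrite expg1.
  by exists 2%N; rewrite expg2 -pres_class_cat.
have [m ->] := baseE x; have [n ->] := baseE y.
exact: commuteX2.
Qed.

(** As [x ^ y] is y^-1 x y, this conjugates the second copy to t x t^-1. On glued vertices both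
    values agree because t commutes with every generator in its star. *)
Lemma double_word_copy b x :
  pres_class RG (double_word (double_copy (star t) b x)) =
  if b then pres_class RG (base_word x) ^ (gen t)^-1
  else pres_class RG (base_word x).
Proof.
case: b => //=; rewrite /double_copy; case: insubP => [y xNt yx|].
  have /negbTE xt : x != t by apply: contraNneq xNt => ->; rewrite setU11.
  rewrite /= /base_word xt yx conjgE invgK /gen -pres_class_inv.
  rewrite -[[:: _; _; _]]/([:: (t, false)] ++ [:: (x, false)] ++
    word_inv [:: (t, false)]).
  by rewrite !pres_class_cat.
rewrite negbK => xS /=; symmetry; apply/conjg_fixP/commgP.
apply: commuteV; move: xS; rewrite !inE => /orP[/eqP ->|tx].
  rewrite /base_word eqxx (pres_class_cat RG [:: _] [:: _]) -/(gen t).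
  by rewrite /commute mulgA.
have /negbTE xt : x != t by apply: contraTneq tx => ->; rewrite adj_irr.
rewrite /base_word xt; apply: commute_sym.
by apply: word_comm_commute; exact: RaagRelator.
Qed.

(** An edge of the double lies in a single copy, so both endpoints are conjugated by the same
    element. *)
Lemma double_word_rel r : RD r ->
  pres_class RG (subst_word double_word r) = 1.
Proof.
case=> u v /existsP[b /existsP[x /existsP[y /and3P[xy /eqP <- /eqP <-]]]].
apply: subst_word_comm; rewrite !double_word_copy.
have := base_word_commute xy; case: b => // cxy.
by rewrite /commute -!conjMg cxy.
Qed.

(** * Reidemeister-Schreier rewriting *)

Definition rw_step (b : bool) (a : Gamma * bool) : bool := b (+) (a.1 == t).

(* A letter (x, true) is an inverse, so b == a.2 silences exactly t read in
   state 0 and t^-1 read in state 1. *)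
Definition rw_emit (b : bool) (a : Gamma * bool) : word D :=
  if (a.1 == t) && (b == a.2) then [::]
  else [:: (double_copy (star t) b a.1 : D, a.2)].

Fixpoint rewriting (b : bool) (w : word Gamma) : word D :=
  if w is a :: w' then rw_emit b a ++ rewriting (rw_step b a) w' else [::].

Lemma rewriting_cat b u v :
  rewriting b (u ++ v) = rewriting b u ++ rewriting (foldl rw_step b u) v.
Proof. by elim: u b => //= a u IHu b; rewrite IHu catA. Qed.

Lemma double_copy_star b x : x \in star t -> double_copy (star t) b x = inl x.
Proof. by case: b => //= xS; rewrite /double_copy insubN // negbK. Qed.

Lemma rewriting_cancel b x c :
  pres_eq RD (rewriting b [:: (x, c); (x, ~~ c)]) [::].
Proof.
rewrite /= /rw_emit /rw_step /=.
case: (x =P t) => [->|_] /=; last by rewrite addbF; exact: (pres_cancel _ [::]).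
rewrite !(double_copy_star _ (setU11 _ _)).
(* The two letters t and t^-1 are either both silent or both emitted. *)
by case: b c => -[] /=; (exact: pres_refl || exact: (pres_cancel _ [::])).
Qed.

Lemma rewriting_comm b x y : adj x y ->
  pres_eq RD (rewriting b (word_comm x y)) [::].
Proof.
move=> xy; pose cp c z : D := double_copy (star t) c z.
have rel c : pres_eq RD (word_comm (cp c x) (cp c y)) [::].
  have /(pres_rel [::] [::]) // : RD (word_comm (cp c x) (cp c y)).
  apply: RaagRelator; apply/existsP; exists c; apply/existsP; exists x.
  by apply/existsP; exists y; rewrite xy !eqxx.
have yNx : y != x by apply: contraTneq xy => ->; rewrite adj_irr.
move: (rel false) (rel b); rewrite /cp /= /rw_emit /rw_step /=.
(* If x = t then y is glued: state 0 emits the whole commutator, state 1 silences both t-letters and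
   leaves y^-1 y. The case y = t is analogous; otherwise the state stays b and the output is a
   relator of copy b. *)
case: (x =P t) => [xt|_].
  have yS : y \in star t by rewrite !inE -xt xy orbT.
  have xS : x \in star t by rewrite xt setU11.
  have -> : (y == t) = false by rewrite -xt (negbTE yNx).
  rewrite !(double_copy_star _ yS) !(double_copy_star _ xS).
  by case: b => //= _ _; exact: (pres_cancel _ [::]).
case: (y =P t) => [yt|_] /=; last by rewrite !addbF.
have yS : y \in star t by rewrite yt setU11.
have xS : x \in star t by rewrite !inE -yt adj_sym xy orbT.
rewrite !(double_copy_star _ yS) !(double_copy_star _ xS).
by case: b => //= _ _; exact: (pres_cancel _ [::]).
Qed.

(** The final state is tracked too, since it determines how a suffix is rewritten. *)
Lemma rewriting_eq u v : pres_eq RG u v ->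
  forall b, foldl rw_step b u = foldl rw_step b v /\
            pres_eq RD (rewriting b u) (rewriting b v).
Proof.
have ctx b u' r v' : (forall c, foldl rw_step c r = c) ->
    (forall c, pres_eq RD (rewriting c r) [::]) ->
    foldl rw_step b (u' ++ r ++ v') = foldl rw_step b (u' ++ v') /\
    pres_eq RD (rewriting b (u' ++ r ++ v')) (rewriting b (u' ++ v')).
  move=> st eq1; rewrite !foldl_cat st !rewriting_cat st; split=> //.
  exact: pres_eq_ctx (rewriting _ u') _ _ _ (eq1 _).
elim=> [{}u b|{}u {}v _ IH b|{}v {}u w _ IH1 _ IH2 b|{}u x c {}v b|
        {}u r {}v [x y xy] b].
- by split=> //; exact: pres_refl.
- by have [-> ?] := IH b; split=> //; exact: pres_sym.
- have [-> uv] := IH1 b; have [-> vw] := IH2 b.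
  by split=> //; exact: pres_trans vw.
- apply: ctx => d; last exact: rewriting_cancel.
  by rewrite /= /rw_step addbK.
- apply: ctx => d; last exact: rewriting_comm.
  (* Each generator occurs twice in a commutator, so the parity is restored. *)
  by rewrite /= /rw_step /= -!addbA; case: d (x == t) (y == t) => [] [] [].
Qed.

(** Each generator's image has an even number of t-letters, so state 0 recurs after every letter;
    the equality is literal, without reduction. *)
Lemma rewritingK w : rewriting false (subst_word double_word w) = w.
Proof.
elim: w => // -[z c] w IHw.
rewrite -cat1s subst_word_cat rewriting_cat.
suff [-> ->] : foldl rw_step false (subst_word double_word [:: (z, c)]) = false
    /\ rewriting false (subst_word double_word [:: (z, c)]) = [:: (z, c)].
  by rewrite IHw.
rewrite /subst_word /= cats0 /subst_letter /=.
case: z => [x|y] /=.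
  rewrite /base_word; case: (x =P t) => [->|/eqP/negbTE xt].
    case: c; rewrite /= /rw_step /rw_emit /= eqxx //=.
    by rewrite insubN // negbK setU11.
  by case: c; rewrite /= /rw_step /rw_emit /= xt.
have /negbTE yt : val y != t.
  by apply: contraNneq (valP y) => ->; rewrite setU11.
case: c; rewrite /= /rw_step /rw_emit /= eqxx yt /=;
  by rewrite /double_copy valK.
Qed.

End DoubleAlongStar.

Theorem corollary5 (Gamma : graph) (t : Gamma) :
  embeds (raag (graph_double (star t))) (raag Gamma).
Proof.
pose f : raag (graph_double (star t)) -> raag Gamma :=
  @subst_morph _ _ (@double_word Gamma t) _ _.
have fM : {morph f : g h / g * h}.
  by apply: subst_morphM; exact: double_word_rel.
pose fm := isMultiplicative.Build _ _ f fM.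
pose F : {multiplicative raag (graph_double (star t)) -> raag Gamma} :=
  HB.pack f fm.
(* Equal images have equivalent rewritings, which are the original representatives. *)
exists F => g h /pres_classP /(rewriting_eq t) /(_ false)[_].
by rewrite !rewritingK => /pres_classP; rewrite !pres_reprK.
Qed.
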